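(* Let $\{U(S)\}_{\emptyset\neq S\subseteq N}$ be the NTU LP game given by $A\in\mathbb{Q}^{K\times J}$, $\{b^i\}_{i\in N}\subset\mathbb{Q}^K$ and $\{v^i\}_{i\in N}\subset\mathbb{Q}^J$, where $X(\{i\})$ is non-empty and bounded for every $i\in N$. If $$v^i\in\bigcap_{S\in 2^N\setminus\{\emptyset\}}X^*(S)\qquad\text{for all } i\in N,$$ then the game is balanced and its core satisfies $C(N)\neq\emptyset$.
   Context: Let $N$ (players), $K$ (resources), $J$ (public goods) be finite non-empty sets. The data are a production matrix $A\in\mathbb{Q}^{K\times J}$, resource endowments $b^i\in\mathbb{Q}^K$ and valuation vectors $v^i\in\mathbb{Q}^J$ for $i\in N$. For a coalition $\emptyset\neq S\subseteq N$ put $b(S)=\sum_{i\in S}b^i$ and $$X(S)=\{x\in\mathbb{R}^J_{\geq 0}: Ax\leq b(S)\},$$ $$Z(S)=\{(x,u)\in\mathbb{R}^J\times\mathbb{R}^N: x\in X(S),\ u_i\leq (v^i)^Tx\ \ \forall i\in S\},$$ $$U(S)=\mathrm{proj}_u(Z(S))\subseteq\mathbb{R}^N .$$ (Coordinates $u_i$, $i\notin S$, are unconstrained in $U(S)$.) The collection $\{U(S)\}_{\emptyset\neq S\subseteq N}$ is the non-transferable utility linear production (NTU LP) game given by $A,\{b^i\},\{v^i\}$. Its core is $$C(N)=U(N)\setminus\bigcup_{\emptyset\neq S\subseteq N}\mathrm{int}(U(S)),$$ with interior taken in $\mathbb{R}^N$. The dual cone of $X(S)$ is $X^*(S)=\{v\in\mathbb{R}^J: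 v^Tx\geq 0\ \ \forall x\in X(S)\}$. A collection $\mathcal{S}\subseteq 2^N\setminus\{\emptyset\}$ is balanced if there exist weights $\lambda^S\geq 0$, $S\in\mathcal{S}$, with $\sum_{S\in\mathcal{S}: i\in S}\lambda^S=1$ for all $i\in N$. The game is balanced if $\bigcap_{S\in\mathcal{S}}U(S)\subseteq U(N)$ for every balanced collection $\mathcal{S}$. *)

(* Defs.v *)
From HB Require Import structures.
From mathcomp Require Import all_boot all_order all_algebra.
From mathcomp Require Import all_classical all_reals all_analysis.
Set Implicit Arguments.
Unset Strict Implicit.
Unset Printing Implicit Defensive.
Import Order.TTheory GRing.Theory Num.Theory.
Import numFieldNormedType.Exports.
Local Open Scope classical_set_scope.
Local Open Scope ring_scope.

(* Players, resources and public goods are ordinals ['I_n], ['I_k], ['I_j];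
   coalitions are finite sets [{set 'I_n}] ([%SET] scope), whereas X(S), Z(S),
   U(S) are sets in the sense of [classical_sets].  The theory is stated over
   an arbitrary complete ordered field [R]; rational data are mapped into [R]
   by [ratr]. *)

Section NTUGame.
Variables (R : realType) (n : nat).

(* When [0 < n], [U] is only ever evaluated at nonempty coalitions: its value at
   the empty set is junk and irrelevant. *)
Implicit Type U : {set 'I_n} -> set 'cV[R]_n.

Definition core U : set 'cV[R]_n :=
  U [set: 'I_n]%SET `\`
    \bigcup_(S in [set S : {set 'I_n} | S != finset.set0]) (U S)°.

Definition balanced_collection (C : {set {set 'I_n}}) : Prop :=
  finset.set0 \notin C /\
  exists w : {set 'I_n} -> R,
    (forall S, S \in C -> 0 <= w S) /\
    (forall i : 'I_n, \sum_(S in C | i \in S) w S = 1).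

Definition balanced_game U : Prop :=
  forall C : {set {set 'I_n}}, balanced_collection C ->
    \bigcap_(S in [set S | S \in C]) U S `<=` U [set: 'I_n]%SET.

End NTUGame.

Section NTULP.
Variables (R : realType) (n k j : nat).
Variables (A : 'M[rat]_(k, j)) (b : 'I_n -> 'cV[rat]_k) (v : 'I_n -> 'cV[rat]_j).

Definition endowment (S : {set 'I_n}) : 'cV[rat]_k := \sum_(i in S) b i.

Definition feasible (S : {set 'I_n}) : set 'cV[R]_j :=
  [set x : 'cV[R]_j | (forall l, 0 <= x l 0) /\
           (forall r, (map_mx ratr A *m x) r 0 <= ratr (endowment S r 0))].

Definition dual_cone (X : set 'cV[R]_j) : set 'cV[R]_j :=
  [set y : 'cV[R]_j | forall x, X x -> 0 <= (y^T *m x) 0 0].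

Definition valuation (i : 'I_n) : 'cV[R]_j := map_mx ratr (v i).

Definition ntulp_lift (S : {set 'I_n}) : set ('cV[R]_j * 'cV[R]_n) :=
  [set xu : 'cV[R]_j * 'cV[R]_n | feasible S xu.1 /\
            (forall i, i \in S -> xu.2 i 0 <= ((valuation i)^T *m xu.1) 0 0)].

Definition ntulp (S : {set 'I_n}) : set 'cV[R]_n := snd @` ntulp_lift S.

End NTULP.

Arguments feasible R {n k j} A b S _ : rename.
Arguments valuation R {n j} v i.
Arguments ntulp R {n k j} A b v S _ : rename.

(* Main.v *)
Require Import Defs.
From HB Require Import structures.
From mathcomp Require Import all_boot all_order all_algebra.
From mathcomp Require Import all_classical all_reals all_analysis.
From mathcomp Require Import zify ring lra.
Set Implicit Arguments.
Unset Strict Implicit.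
Unset Printing Implicit Defensive.
Import Order.TTheory GRing.Theory Num.Theory.
Import numFieldNormedType.Exports.

(* Balancedness: if [u] lies in U(S) through [x_S] for all S in a balanced family with
   weights [w_S], then [u] lies in U(N) through the sum of the [w_S x_S]: the resource
   constraints add up to b(N), and the terms of coalitions that do not contain [i]
   contribute nonnegatively to [i]'s value because [v^i] is in every dual cone.

   Nonemptiness of the core is Scarf's theorem for balanced games.  Lift each point [x]
   of a large simplex vertically onto the frontier of the union of the U(S), so that no
   coalition blocks the lifted point, and let G_i(x) be the total slack, up to [e], of
   the coalitions containing [i] that are nearly effective there.  If all G_i(x) agree,
   the nearly effective coalitions are balanced, so the lifted point is within [e] of
   U(N).  Such an [x] is found by coloring a fine grid with an index [i] for which
   G_i(x) is at most the mean of the G_l(x): Scarf's lemma, proved by a parity argument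
   in the style of Sperner, yields nearby grid points of all relevant colors.  Two
   compactness arguments then remove the mesh and [e]. *)
(** * Scarf's combinatorial lemma *)

Section ScarfLemma.
Import mathcomp.boot.fintype mathcomp.boot.finset.
Variables (n : nat) (E : finType) (h : 'I_n.+1 -> E -> nat).
Hypothesis h_inj : forall i, injective (h i).

(** The condition of Scarf's primitive sets without their cardinality: for nonempty [r], no [t]
    beats the minimum of [r] in every order at once. *)
Definition dominant (r : {set E}) : bool :=
  [forall t, exists i, forall s in r, h i t <= h i s].

Lemma dominantP (r : {set E}) :
  reflect (forall t, exists i, forall s, s \in r -> h i t <= h i s) (dominant r).
Proof.
apply: (iffP forallP) => H t.
  by have /existsP[i /forall_inP Hi] := H t; exists i.
by have [i Hi] := H t; apply/existsP; exists i; apply/forall_inP.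
Qed.

Lemma dominant_sub (d r : {set E}) : d \subset r -> dominant r -> dominant d.
Proof.
move=> /subsetP dr /dominantP H; apply/dominantP => t.
by have [i Hi] := H t; exists i => s /dr /Hi.
Qed.

(** * Completions of a dominant set of cardinal [n] *)

Section Completions.
Variables (d : {set E}) (s0 : E).
Hypotheses (s0d : s0 \in d) (d_dom : dominant d) (d_card : #|d| = n).

Let mn i := [arg min_(s < s0 in d) h i s].

Let mn_in i : mn i \in d.
Proof. by rewrite /mn; case: arg_minnP. Qed.

Let mn_le i s : s \in d -> h i (mn i) <= h i s.
Proof. by rewrite /mn; case: arg_minnP => // t _ + sd; apply. Qed.

Let mn_unique i s : s \in d -> (forall t, t \in d -> h i s <= h i t) -> s = mn i.
Proof.
move=> sd smin; apply: (@h_inj i); apply/eqP.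
by rewrite eqn_leq mn_le // smin.
Qed.

Let mn_onto s : s \in d -> exists i, s = mn i.
Proof.
by move=> sd; have [i Hi] := dominantP _ d_dom s; exists i; apply: mn_unique.
Qed.

Let mn_image : mn @: [set: 'I_n.+1] = d.
Proof.
apply/setP => s; apply/imsetP/idP => [[i _ ->]|/mn_onto[i ->]]; first exact: mn_in.
by exists i.
Qed.

(** An existential replaces the comparison with [mn l], so that the set does not depend on the
    default [s0]. *)
Definition improving i :=
  [set t | [forall l, (l != i) ==> [exists s in d, h l s < h l t]]].

Let improvingP i t :
  reflect (forall l, l != i -> h l (mn l) < h l t) (t \in improving i).
Proof.
rewrite inE; apply: (iffP forallP) => H l.
  move=> li; have /implyP/(_ li)/existsP[s /andP[sd]] := H l.
  exact/leq_ltn_trans/mn_le.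
by apply/implyP => li; apply/existsP; exists (mn l); rewrite mn_in H.
Qed.

(** A common element would beat the minimum of [d] in every order, against dominance. *)
Let not_improving2 i i' t : i != i' -> t \in improving i -> t \notin improving i'.
Proof.
move=> ii' /improvingP ti; apply/negP => /improvingP ti'.
have [k Hk] := dominantP _ d_dom t.
have : h k (mn k) < h k t.
  by have [->|] := eqVneq k i; [exact: ti'|exact: ti].
by rewrite ltnNge Hk.
Qed.

(** Pigeonhole: [mn] maps [n.+1] indices onto the [n] elements of [d], so exactly one value is taken
    twice. *)
Let collision :
  exists i i', [/\ i != i', mn i = mn i' & {in predC1 i &, injective mn}].
Proof.
have /injectivePn[i [i' ii' e]] : ~~ injectiveb mn.
  apply/injectiveP => inj; have := card_imset (mem [set: 'I_n.+1]) inj.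
  by rewrite mn_image d_card cardsT card_ord => /n_Sn.
exists i, i'; split=> //; apply/imset_injP.
rewrite -[X in _ == X]/(#|predC1 i|) cardC1 card_ord -[X in _ == X]d_card -mn_image.
apply/eqP/eq_card => s; apply/imsetP/imsetP => -[k _ ->]; first by exists k.
have [->|ki] := eqVneq k i; last by exists k.
by exists i'; rewrite // inE eq_sym.
Qed.

Let is_completion t :=  (t \notin d) && dominant (t |: d).

(** A challenger [t'] either lies in [improving i], and then order [i] stops it because [t] is
    maximal there, or is below [mn l] in some order [l != i], and hence below [t]. *)
Let improving_completion i i' t : i != i' -> mn i = mn i' ->
  t \in improving i -> (forall t', t' \in improving i -> h i t' <= h i t) ->
  is_completion t.
Proof.
move=> ii' e /[dup] ti /improvingP imp_t max_t; apply/andP; split.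
  apply/negP => /mn_onto[k tk].
  have [ki|/imp_t] := eqVneq k i; last by rewrite tk ltnn.
  by have := imp_t i'; rewrite -e -ki -tk ltnn eq_sym ki => /(_ ii').
apply/dominantP => t'; have [k Hk] := dominantP _ d_dom t'.
have [/forallP t'i|] := boolP [forall l, (l != i) ==> (h l (mn l) < h l t')].
  exists i => s /setU1P[->|sd].
    by apply/max_t/improvingP => l li; apply: (implyP (t'i l)).
  have [ki|ki] := eqVneq k i; first by rewrite -ki Hk.
  by have := implyP (t'i k) ki; rewrite ltnNge Hk.
case/forallPn => l; rewrite negb_imply -leqNgt => /andP[li t'l].
exists l => s /setU1P[->|sd]; last exact: leq_trans t'l (mn_le _ sd).
exact: leq_trans t'l (ltnW (imp_t _ li)).
Qed.

(** In [t |: d] every element is the minimum of some order. If [t] takes over order [l], then [mn l]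
    needs a second order, so [l] belongs to the colliding pair. *)
Let completion_improving i i' t : i != i' -> mn i = mn i' ->
  {in predC1 i &, injective mn} ->
  is_completion t ->
  exists2 l, (l == i) || (l == i') &
    t \in improving l /\ forall t', t' \in improving l -> h l t' <= h l t.
Proof.
move=> ii' e inj /andP[td /dominantP dom].
have lt_t l s : s \in d -> h l s <= h l t -> h l s < h l t.
  move=> sd; rewrite leq_eqVlt => /orP[/eqP/h_inj st|//].
  by rewrite -st sd in td.
have owner s : s \in d -> exists2 l, s = mn l & h l s < h l t.
  move=> sd; have [l Hl] := dom s; exists l.
    by apply: mn_unique => // u ud; apply/Hl/setU1P; right.
  by apply: lt_t => //; apply/Hl/setU1P; left.
have same k l : mn k = mn l -> k != l ->
    [/\ (k == i) || (k == i'), (l == i) || (l == i') &  (k == i) || (l == i)].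
  have [->|ki] := eqVneq k i; have [->|li] := eqVneq l i => // kl nkl.
  - split => //; rewrite (inj l i') ?eqxx // ?inE 1?eq_sym //.
    by rewrite -kl e.
  - split => //; rewrite ?orbT // (inj k i') ?eqxx // ?inE 1?eq_sym //.
    by rewrite kl e.
  - by rewrite (inj k l) ?eqxx // in nkl.
have [l Hl] := dom t.
have tl s : s \in d -> h l t <= h l s by move=> sd; apply/Hl/setU1P; right.
have imp k : k != l -> h k (mn k) < h k t.
  move=> kl; have [l' kl' lt'] := owner _ (mn_in k).
  have [<-|nkl'] := eqVneq l' k; first by rewrite -kl'.
  have l'l : l' != l.
    by apply: contraTneq lt' => ->; rewrite -leqNgt tl.
  have [] := same _ _ kl'; first by rewrite eq_sym.
  (* Now [l], [k] and [l'] would be three distinct members of the pair [i], [i']; [m] serves to show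
     that [l] belongs to it. *)
  have [m lm ltm] := owner _ (mn_in l).
  have ml : m != l by apply: contraTneq ltm => ->; rewrite -leqNgt tl.
  have [] := same _ _ lm; first by rewrite eq_sym.
  move=> lii' _ _ kii' l'ii' _.
  case/orP: lii' kl l'l => /eqP -> => [/negPf a /negPf b|/negPf a /negPf b];
  move: kii' l'ii' nkl'; rewrite a b ?orbF /= => /eqP -> /eqP ->; by rewrite eqxx.
exists l; last first.
  split; first exact/improvingP.
  move=> t' /improvingP t'l; have [k Hk] := dom t'.
  have [kl|/t'l] := eqVneq k l; first by rewrite -kl Hk // !inE eqxx.
  by rewrite ltnNge Hk // !inE mn_in orbT.
have [m lm ltm] := owner _ (mn_in l).
have ml : m != l by apply: contraTneq ltm => ->; rewrite -leqNgt tl.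
by have [] := same _ _ lm; first by rewrite eq_sym.
Qed.

(** For the colliding pair, the two completions are the top elements of [improving i] and of
    [improving i'], which are disjoint sets. *)
Lemma card_completions : (forall i, improving i != set0) ->
  #|[set t | (t \notin d) && dominant (t |: d)]| = 2.
Proof.
move=> imp0; have [i [i' [ii' e inj]]] := collision.
have i'i : i' != i by rewrite eq_sym.
have best k : exists2 t, t \in improving k &
    forall t', t' \in improving k -> h k t' <= h k t.
  have /set0Pn[t0 t0k] := imp0 k.
  by case: (arg_maxnP (h k) t0k) => t tk tmax; exists t.
have [t ti tmax] := best i; have [t' ti' tmax'] := best i'.
have tt' : t != t'.
  by apply: contraTneq ti' => <-; apply: not_improving2 ti.
suff -> : [set t | (t \notin d) && dominant (t |: d)] = [set t; t'].
  by rewrite cards2 tt'.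
apply/setP => u; rewrite inE; apply/idP/set2P => [/(completion_improving ii' e inj)|].
  have eq_max l x y : x \in improving l -> y \in improving l ->
    (forall z, z \in improving l -> h l z <= h l x) ->
    (forall z, z \in improving l -> h l z <= h l y) -> x = y.
    by move=> xl yl mx my; apply: (@h_inj l); apply/eqP; rewrite eqn_leq my ?mx.
  case=> l /orP[]/eqP-> [ul umax]; [left|right]; exact: eq_max umax _.
by case=> ->; [apply: (improving_completion ii')|apply: (improving_completion i'i)].
Qed.

End Completions.

(** * Colorings, doors and the parity argument *)

Variables (e : 'I_n.+1 -> E) (c : E -> 'I_n.+1) (x0 : E).
Hypothesis e_min : forall i t, h i (e i) <= h i t.
Hypothesis e_max : forall i l t, i != l -> (forall k, t != e k) -> h l t < h l (e i).
Hypothesis x0_proper : forall k, x0 != e k.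
Hypothesis ce : forall i, c (e i) = i.

Let door (d : {set E}) := c @: d == ~: [set ord0].

Let corner : {set E} := e @: ~: [set ord0].

Let card_setC0 : #|~: [set (ord0 : 'I_n.+1)]| = n.
Proof. by rewrite cardsCs setCK cards1 card_ord subn1. Qed.

(** If [r :\ s] is a door, its colors are distinct and [c s] repeats exactly one of them, at [s'];
    the doors are then those that omit [s] or [s']. *)
Let doors_of_room (r : {set E}) : #|r| = n.+1 -> c @: r != [set: 'I_n.+1] ->
  2 %| #|[set s in r | door (r :\ s)]|.
Proof.
move=> r_card r_notfull.
have [->|/set0Pn[s]] := eqVneq [set s in r | door (r :\ s)] set0.
  by rewrite cards0.
rewrite inE => /andP[sr /eqP ds].
have c_inj : {in r :\ s &, injective c}.
  apply/imset_injP; rewrite ds card_setC0.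
  by move: (cardsD1 s r); rewrite sr r_card add1n => -[<-].
have : c s \in c @: (r :\ s).
  rewrite ds !inE; apply: contra r_notfull => /eqP cs.
  by rewrite -(setD1K sr) imsetU1 ds cs setUCr.
case/imsetP => s' s'rs css'; have /setD1P[s's s'r] := s'rs.
suff -> : [set s in r | door (r :\ s)] = [set s; s'] by rewrite cards2 eq_sym s's.
apply/setP => u; rewrite inE; apply/andP/set2P => [[ur du]|[]->].
- have [->|us] := eqVneq u s; [by left|right].
  have urs : u \in r :\ s by rewrite !inE us.
  have : c u \in c @: (r :\ u) by rewrite (eqP du) -ds imset_f.
  case/imsetP => y /setD1P[yu yr] cuy.
  have [ys|ys] := eqVneq y s; first by apply: c_inj; rewrite // cuy ys.
  by case/eqP: yu; apply: c_inj; rewrite // !inE ys.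
- by rewrite sr /door ds.
- split=> //; rewrite /door -ds; apply/eqP/setP => k.
  apply/imsetP/imsetP => -[y /setD1P[ny yr] ->].
    have [->|ys] := eqVneq y s; first by exists s'.
    by exists y; rewrite // !inE ys.
  have [->|ys] := eqVneq y s'; last by exists y; rewrite // !inE ys.
  by exists s; rewrite // !inE eq_sym s's.
Qed.

(** Each [e i] in the corner is least in order [i], so only order [ord0] can stop a challenger
    outside the corner: the added element must be the largest one there. *)
Let rooms_of_corner :
  #|[set t | (t \notin corner) && dominant (t |: corner)]| = 1.
Proof.
have e_in l : (e l \in corner) = (l != ord0).
  apply/imsetP/idP => [[k + /(congr1 c)]|l0]; last by exists l; rewrite // !inE.
  by rewrite !ce !inE => + ->.
have [t tc tmax] : exists2 t, t \notin corner &
    forall t', t' \notin corner -> h ord0 t' <= h ord0 t.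
  have x0c : x0 \notin corner.
    by apply/imsetP => -[k _ xk]; have := x0_proper k; rewrite xk eqxx.
  by case: (arg_maxnP (P := fun t => t \notin corner) (h ord0) x0c) => t; exists t.
apply/eqP/cards1P; exists t; apply/setP => u; rewrite 2!inE; apply/andP/eqP.
  case=> uc /dominantP /(_ t)[i Hi].
  apply: (@h_inj ord0); apply/eqP; rewrite eqn_leq tmax //=.
  have [<-|i0] := eqVneq i ord0; first by rewrite Hi // !inE eqxx.
  have ei : e i \in corner by rewrite e_in.
  have /h_inj ti : h i t = h i (e i).
    by apply/eqP; rewrite eqn_leq e_min andbT Hi // !inE ei orbT.
  by rewrite ti ei in tc.
move=> ->; split=> //; apply/dominantP => t'.
have [/imsetP[k _ ->]|t'c] := boolP (t' \in corner); first by exists k => s _.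
exists ord0 => s /setU1P[->|]; first exact: tmax.
case/imsetP => k; rewrite !inE => k0 ->.
have [/forallP t'p|] := boolP [forall l, t' != e l]; first exact/ltnW/e_max.
case/forallPn => l; rewrite negbK => /eqP t'l.
move: t'c; rewrite t'l e_in negbK => /eqP ->; exact: e_min.
Qed.

(** A door other than [corner] has an element [s] outside the image of [e]. Each [e i] beats [s] in
    all orders but [i], so [card_completions] applies. *)
Let rooms_of_door d : door d -> #|d| = n -> d != corner ->
  2 %| #|[set t | (t \notin d) && dominant (t |: d)]|.
Proof.
move=> d_door d_card d_corner.
have [d_dom|d_ndom] := boolP (dominant d); last first.
  suff -> : [set t | (t \notin d) && dominant (t |: d)] = set0 by rewrite cards0.
  apply/setP => t; rewrite !inE; apply/negP => /andP[_].
  by move/(dominant_sub (subsetUr _ _)); apply/negP.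
have [s sd sp] : exists2 s, s \in d & forall k, s != e k.
  suff /subsetPn[s sd /imsetP sp] : ~~ (d \subset corner).
    exists s => // k; apply/eqP => sk; apply: sp; exists k => //.
    by rewrite -(eqP d_door) -(ce k) -sk imset_f.
  apply: contra d_corner => dc; rewrite eqEcard dc d_card /=.
  by rewrite (leq_trans (leq_imset_card _ _)) ?card_setC0.
rewrite (card_completions sd) // => i; apply/set0Pn; exists (e i).
rewrite inE; apply/forallP => l; apply/implyP => li; apply/existsP.
by exists s; rewrite sd e_max // eq_sym.
Qed.

(* A parity count of the pairs (room, door of it) as for Sperner's lemma: rooms
   are dominant sets of cardinal [n.+1], and a door misses exactly the color
   [ord0]; [corner] is the only door that belongs to an odd number of rooms. *)
Theorem scarf_lemma : exists2 r, dominant r & c @: r = [set: 'I_n.+1].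
Proof.
have [/existsP[r /andP[rd /eqP rT]]|none] :=
  boolP [exists r, dominant r && (c @: r == [set: 'I_n.+1])]; first by exists r.
pose room r := dominant r && (#|r| == n.+1).
pose P r s := [&& room r, s \in r & door (r :\ s)].
have even : 2 %| \sum_r \sum_s P r s.
  apply: dvdn_sum => r _.
  have [/andP[r_dom /eqP r_card]|nr] := boolP (room r); last first.
    by rewrite big1 // => s _; rewrite /P (negPf nr).
  rewrite (eq_bigr (fun s => (s \in [set s in r | door (r :\ s)] : nat))).
    rewrite -big_mkcond sum1_card doors_of_room //.
    by move/existsPn/(_ r): none; rewrite r_dom.
  by move=> s _; rewrite /P inE /room r_dom r_card eqxx.
(* Count by doors instead of rooms: a room containing [s] is [s |: d] for a unique [d] avoiding
   [s]. *)
have swap s : \sum_r P r s = \sum_(d : {set E} | s \notin d) P (s |: d) s.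
  rewrite (bigID (fun r : {set E} => s \in r)) /= [X in _ + X]big1 ?addn0; last first.
    by move=> r /negPf sr; rewrite /P sr andbF.
  rewrite (reindex_onto (fun d : {set E} => s |: d) (fun r : {set E} => r :\ s));
    last by move=> r; exact: setD1K.
  apply: eq_bigl => d; rewrite setU11 /=; apply/eqP/idP => [<-|]; first by rewrite setD11.
  exact: setU1K.
have eqsum : \sum_r \sum_s P r s =
    \sum_(d : {set E} | door d && (#|d| == n)) #|[set t | (t \notin d) && dominant (t |: d)]|.
  rewrite exchange_big /=; under eq_bigr do rewrite swap big_mkcond /=.
  rewrite exchange_big /= [RHS]big_mkcond /=; apply: eq_bigr => d _.
  case: ifPn => [/andP[d_door /eqP d_card]|d_ndoor]; last first.
    rewrite big1 // => s _; case: ifPn => // sd; apply/eqP; rewrite eqb0.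
    rewrite /P setU1K // /room cardsU1 sd eqSS setU11 /=.
    by apply: contra d_ndoor => /andP[/andP[_ ->] ->].
  rewrite -sum1_card [RHS]big_mkcond; apply: eq_bigr => s _; rewrite inE.
  case: ifPn => sd //=; rewrite /P setU11 setU1K // d_door /room cardsU1 sd d_card.
  by rewrite eqxx !andbT; case: dominant.
move: even; rewrite eqsum (bigD1 corner) /=; last first.
  have cc : c @: corner = ~: [set ord0].
    by rewrite /corner -imset_comp (eq_imset (g := id)) ?imset_id.
  have -> : door corner by apply/eqP.
  rewrite -[X in _ == X]card_setC0 card_imset ?eqxx //.
  by move=> i k /(congr1 c); rewrite !ce.
rewrite rooms_of_corner dvdn_addl //.
by apply: dvdn_sum => d /andP[/andP[dd /eqP dn] dc]; apply: rooms_of_door.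
Qed.

End ScarfLemma.

(* A substitute for Sperner's lemma that needs no triangulation: Scarf's lemma for
   the coordinate orders, made linear by breaking ties with [enum_rank]. *)
Lemma grid_coloring (n m : nat) (c : ('I_n.+1 -> nat) -> 'I_n.+1) :
  exists2 s : 'I_n.+1 -> nat, \sum_i s i = m &
    forall i, (exists s' : 'I_n.+1 -> nat, [/\ \sum_l s' l = m, c s' = i &
                 forall l, s l <= s' l + n.+1 /\ s' l <= s l + n.+1])
              \/ s i <= n.+1.
Proof.
pose T := {x : {ffun 'I_n.+1 -> 'I_m.+1} | \sum_i x i == m :> nat}.
pose co (x : T) (i : 'I_n.+1) : nat := val x i.
have co_sum x : \sum_i co x i = m by apply/eqP/(valP x).
have mkT (f : 'I_n.+1 -> nat) : \sum_i f i = m -> exists x, co x =1 f.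
  move=> fm; have fle i : f i < m.+1 by rewrite ltnS -fm (bigD1 i) //= leq_addr.
  pose g : {ffun 'I_n.+1 -> 'I_m.+1} := [ffun i => inord (f i)].
  have gf i : g i = f i :> nat by rewrite ffunE inordK.
  have gP : \sum_i g i == m :> nat by rewrite -[X in _ == X]fm; apply/eqP/eq_bigr.
  by exists (Sub g gP).
pose B := #|{: T}|.
(* Coordinate first, then rank; the successor leaves 0 free for [inr i], and the other [inr k] lie
   above all grid points. *)
pose h i (t : T + 'I_n.+1) := match t with
  | inl x => (co x i * B + enum_rank x).+1
  | inr k => if k == i then 0 else (m.+1 * B).+1 + k end.
have rank_lt (x : T) : enum_rank x < B by [].
have co_le x i : co x i <= m by rewrite -ltnS ltn_ord.
have h_lt i x : h i (inl x) < (m.+1 * B).+1.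
  by rewrite /h; have := rank_lt x; have := co_le x i; nia.
have h_le i x y : h i (inl x) <= h i (inl y) -> co x i <= co y i.
  by rewrite /h; have := rank_lt x; have := rank_lt y; nia.
have h_inj i : injective (h i).
  move=> [x|k] [y|l] hxy.
  - have cxy : co x i = co y i by apply/eqP; rewrite eqn_leq !h_le // hxy.
    by move: hxy; rewrite /h cxy => -[/addnI/val_inj/enum_rank_inj ->].
  - have := h_lt i x; rewrite hxy; move: hxy; rewrite /h; case: (l == i) => //; lia.
  - have := h_lt i y; rewrite -hxy; move: hxy; rewrite /h; case: (k == i) => //; lia.
  - move: hxy; rewrite /h; case: (eqVneq k i) => [->|_]; case: (eqVneq l i) => [->|_] //.
    by move/addnI/val_inj ->.
pose c' (t : T + 'I_n.+1) := match t with inl x => c (co x) | inr k => k end.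
have [x0 _] : exists x0 : T, True.
  have [|x _] := mkT (fun i => if i == ord0 then m else 0); last by exists x.
  by rewrite -big_mkcond big_pred1_eq.
have [||//|//|r r_dom c'r] := @scarf_lemma n _ h h_inj inr c' (inl x0).
- by move=> i t; rewrite /h eqxx.
- move=> i l [x|k] il; last by move/(_ k); rewrite eqxx.
  by rewrite /h (negPf il); have := h_lt l x; rewrite /h; lia.
(* Colors in [C] must be realized by grid points of [r]; the others may come from the artificial
   vertices. *)
pose C := [pred i | inr i \notin r].
have colored i : C i -> exists2 x, inl x \in r & c (co x) = i.
  move=> iC; have : i \in c' @: r by rewrite c'r.
  by case/imsetP => -[x xr ->|k kr ik]; [exists x|rewrite /= ik /= kr in iC].
have dom x : exists2 i, C i & forall y, inl y \in r -> co x i <= co y i.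
  have [i Hi] := dominantP _ _ r_dom (inl x); exists i => [|y /Hi/h_le//].
  by apply/negP => /Hi; rewrite /h eqxx.
have [i0 i0C _] := dom x0.
have [x xr _] := colored _ i0C.
pose a i := co [arg min_(y < x | inl y \in r) co y i] i.
have a_le i y : inl y \in r -> a i <= co y i.
  by rewrite /a; case: arg_minnP => // z _ + yr; apply.
have a_sum : m < \sum_(i | C i) (a i).+1.
  rewrite ltnNge; set S := \sum_(i | _) _; apply/negP => le_m.
  (* If the sum were at most [m], this grid point would exceed all the minima [a i] with [i] in [C];
     the surplus goes to [i0]. *)
  pose f i := if C i then (a i).+1 + (if i == i0 then m - S else 0) else 0.
  have [|z zf] := mkT f.
    rewrite -big_mkcond big_split /= -big_mkcondr /=.
    rewrite [X in _ + X](big_pred1 i0) ?subnKC // => i /=.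
    by case: eqVneq => [->|]; rewrite ?andbF ?andbT; [exact: i0C|].
  have [i iC /(_ _ _)] := dom z.
  rewrite zf /f iC; have: exists2 y, inl y \in r & a i = co y i.
    by rewrite /a; case: arg_minnP => // y yr _; exists y.
  by case=> y yr -> /(_ _ yr); rewrite addSn ltnNge leq_addr.
have C_le : \sum_(i | C i) 1 <= n.+1.
  by rewrite sum1_card (leq_trans (max_card _)) // card_ord.
rewrite (eq_bigr (fun i => a i + 1)) in a_sum; last by move=> i _; rewrite addn1.
rewrite big_split /= in a_sum.
(* The minima over [C] already use up all but fewer than [n.+1] units of the total [m], which
   confines every grid point of [r]. *)
have in_C y i : inl y \in r -> C i -> co y i <= a i + n.+1.
  move=> yr iC; have := co_sum y; rewrite (bigID C) /= (bigD1 i) //=.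
  move: a_sum; rewrite (bigD1 i) //=.
  have : \sum_(l | C l && (l != i)) a l <= \sum_(l | C l && (l != i)) co y l.
    by apply: leq_sum => l _; apply: a_le.
  move: C_le => /=; lia.
have off_C y i : inl y \in r -> ~~ C i -> co y i <= n.+1.
  move=> yr iC; have := co_sum y; rewrite (bigID C) /= [X in _ + X](bigD1 i) //=.
  have : \sum_(l | C l) a l <= \sum_(l | C l) co y l.
    by apply: leq_sum => l _; apply: a_le.
  move: C_le a_sum => /=; lia.
have close y z l : inl y \in r -> inl z \in r -> co y l <= co z l + n.+1.
  move=> yr zr; have [lC|lC] := boolP (C l); last by have := off_C _ _ yr lC; lia.
  by have := in_C _ _ yr lC; have := a_le l _ zr; lia.
exists (co x) => [|i]; first exact: co_sum.
have [iC|iC] := boolP (C i); last by right; exact: off_C.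
have [y yr cy] := colored _ iC; left; exists (co y).
by split=> // l; split; exact: close.
Qed.

(** * Lipschitz inequalities on boxes *)

Local Open Scope classical_set_scope.
Local Open Scope ring_scope.

Section SupLipschitz.
Variables (R : realType) (n : nat).
Implicit Types (f g : 'cV[R]_n -> R) (L : R).

(** Lipschitz continuity for the sup norm. One side suffices by exchanging [x] and [y], and a bound
    [e] on the coordinates replaces the norm. *)
Definition sup_lipschitz L f :=
  forall (x y : 'cV[R]_n) e, 0 <= e -> (forall l, `|x l 0 - y l 0| <= e) -> f x <= f y + L * e.

Lemma sup_lipschitz_cst a : sup_lipschitz 0 (fun=> a).
Proof. by move=> x y e _ _; rewrite mul0r addr0. Qed.

Lemma sup_lipschitzW L L' f : L <= L' -> sup_lipschitz L f -> sup_lipschitz L' f.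
Proof.
move=> LL' Lf x y e e0 xye; apply: le_trans (Lf _ _ _ e0 xye) _.
by rewrite lerD2l ler_wpM2r.
Qed.

Lemma sup_lipschitzN L f : sup_lipschitz L f -> sup_lipschitz L (fun x => - f x).
Proof.
move=> Lf x y e e0 xye; have : f y <= f x + L * e.
  by apply: Lf => // l; rewrite distrC.
lra.
Qed.

Lemma sup_lipschitzD L L' f g : sup_lipschitz L f -> sup_lipschitz L' g ->
  sup_lipschitz (L + L') (fun x => f x + g x).
Proof. by move=> Lf Lg x y e e0 xye; have := Lf _ _ _ e0 xye; have := Lg _ _ _ e0 xye; lra. Qed.

Lemma sup_lipschitzMl L f a : 0 <= a -> sup_lipschitz L f ->
  sup_lipschitz (a * L) (fun x => a * f x).
Proof.
by move=> a0 Lf x y e e0 xye; rewrite -mulrA -mulrDr ler_wpM2l // Lf.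
Qed.

Lemma sup_lipschitz_sum (I : finType) (P : pred I) (L : I -> R) (f : I -> 'cV[R]_n -> R) :
  (forall i, P i -> sup_lipschitz (L i) (f i)) ->
  sup_lipschitz (\sum_(i | P i) L i) (fun x => \sum_(i | P i) f i x).
Proof.
move=> Lf x y e e0 xye; rewrite mulr_suml -big_split /=.
by apply: ler_sum => i Pi; apply: Lf.
Qed.

Lemma sup_lipschitz_max0 L f : 0 <= L ->
  sup_lipschitz L f -> sup_lipschitz L (fun x => Num.max 0 (f x)).
Proof.
move=> L0 Lf x y e e0 xye; rewrite ge_max; apply/andP; split; last first.
  by apply: le_trans (Lf _ _ _ e0 xye) _; rewrite lerD2r le_max lexx orbT.
by rewrite addr_ge0 ?le_max ?lexx // mulr_ge0.
Qed.

(** Row vectors match the compactness and extreme value statements used in [box_limit]. *)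
Lemma sup_lipschitz_continuous L f :
  sup_lipschitz L f -> continuous (fun v : 'rV[R]_n => f v^T).
Proof.
move=> Lf v; apply/(@cvgrPdist_le _ _ _ _ (nbhs_filter v)) => /= e e0.
have L0 : 0 < `|L| + 1 by rewrite ltr_wpDl.
have d0 : 0 < e / (`|L| + 1) by rewrite divr_gt0.
apply/nbhs_ballP; exists (e / (`|L| + 1)) => //= w [_ vw].
have Le : L * (e / (`|L| + 1)) <= e.
  rewrite mulrCA ger_pMr // ler_pdivrMr // mul1r.
  by rewrite (le_trans (ler_norm _)) // lerDl.
have le (x y : 'cV[R]_n) : (forall l, `|x l 0 - y l 0| <= e / (`|L| + 1)) -> f x <= f y + e.
  by move=> /(Lf _ _ _ (ltW d0))/le_trans; apply; rewrite lerD2l.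
rewrite ler_distl; apply/andP; split; rewrite ?lerBlDr; apply: le => l; rewrite !mxE.
  by rewrite distrC; exact/ltW/vw.
exact/ltW/vw.
Qed.

(** The total violation [phi] attains its minimum on the compact box, and approximate solutions
    force that minimum to be 0. *)
Lemma box_limit (I : finType) (M : R) (L : I -> R) (f : I -> 'cV[R]_n -> R) :
  (forall i, sup_lipschitz (L i) (f i)) ->
  (forall e, 0 < e -> exists2 x : 'cV[R]_n, (forall l, 0 <= x l 0 <= M) &
     forall i, f i x <= e) ->
  exists2 x : 'cV[R]_n, (forall l, 0 <= x l 0 <= M) & forall i, f i x <= 0.
Proof.
move=> Lf apx.
pose phi (v : 'rV[R]_n) := \sum_i Num.max 0 (f i v^T).
pose K := [set v : 'rV[R]_n | forall l, `[0, M]%classic (v 0 l)].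
have boxP (x : 'cV[R]_n) : (forall l, 0 <= x l 0 <= M) -> K x^T.
  by move=> xM l /=; rewrite mxE in_itv /= xM.
have K0 : K !=set0 by have [x xM _] := apx 1 ltr01; exists x^T; apply: boxP.
have cK : compact K.
  by apply: (@rV_compact _ _ (fun=> `[0, M]%classic)) => l; exact: segment_compact.
have cphi : {within K, continuous phi}.
  apply: continuous_subspaceT; apply: (@sup_lipschitz_continuous (\sum_i `|L i|)
    (fun x => \sum_i Num.max 0 (f i x))).
  apply: sup_lipschitz_sum => i _; apply: sup_lipschitz_max0 => //.
  exact: sup_lipschitzW (ler_norm _) (Lf i).
have [v vK vmin] := EVT_min_rV K0 cK cphi.
have phi_ge i w : f i w^T <= phi w.
  rewrite /phi (bigD1 i) //= (le_trans (y := Num.max 0 (f i w^T))) //.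
    by rewrite le_max lexx orbT.
  by rewrite lerDl sumr_ge0 // => k _; rewrite le_max lexx.
have phi0 : phi v <= 0.
  rewrite leNgt; apply/negP => v0.
  (* The successor makes the total violation at [x] strictly smaller than the minimum, and covers an
     empty [I]. *)
  have [|x xM xe] := apx (phi v / (#|I|.+1)%:R); first by rewrite divr_gt0.
  have : phi x^T <= #|I|%:R * (phi v / (#|I|.+1)%:R).
    rewrite mulr_natl -sumr_const; apply: ler_sum => i _.
    by rewrite ge_max trmxK xe divr_ge0 // ltW.
  apply/negP; rewrite -ltNge; apply: lt_le_trans (vmin x^T _); last first.
    by apply/mem_set/boxP.
  by rewrite mulrCA gtr_pMr // ltr_pdivrMr // mul1r ltr_nat.
exists v^T => [l|i]; first by move: vK; rewrite inE mxE => /(_ l) /=; rewrite in_itv.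
exact: le_trans (phi_ge i v) phi0.
Qed.

End SupLipschitz.

(** * Balanced games have nonempty cores *)

Section Height.
Variables (R : realType) (n : nat) (V : set 'cV[R]_n) (M : R).
Hypothesis V_down : forall u u' : 'cV[R]_n, V u -> (forall i, u' i 0 <= u i 0) -> V u'.
Hypothesis V_bound : forall u, V u -> exists i, u i 0 <= M.
Hypothesis V_nonempty : V !=set0.

(** Signed distance to the frontier of [V] along the all-ones direction. The supremum need not be
    attained, hence the strict inequality in [height_gt]. *)
Definition height (u : 'cV[R]_n) : R := sup [set t | V (u + const_mx t)].

Let has_sup_height u : has_sup [set t | V (u + const_mx t)].
Proof.
split.
  have [w Vw] := V_nonempty; exists (- \sum_i `|w i 0 - u i 0|) => /=.
  apply: V_down Vw _ => i; rewrite !mxE (bigD1 i) //=.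
  have : 0 <= \sum_(l | l != i) `|w l 0 - u l 0| by rewrite sumr_ge0.
  have := ler_norm (- (w i 0 - u i 0)); rewrite normrN; lra.
exists (M + \sum_i `|u i 0|) => t /= /V_bound[i]; rewrite !mxE (bigD1 i) //=.
have : 0 <= \sum_(l | l != i) `|u l 0| by rewrite sumr_ge0.
have := ler_norm (- u i 0); rewrite normrN; lra.
Qed.

Lemma height_ge u t : V (u + const_mx t) -> t <= height u.
Proof. by move=> Vt; apply: sup_ubound Vt; have [] := has_sup_height u. Qed.

Lemma height_gt u t : t < height u -> V (u + const_mx t).
Proof.
move=> tu; have e0 : 0 < height u - t by rewrite subr_gt0.
have [s /= Vs] := sup_adherent e0 (has_sup_height u).
rewrite -/(height u) subKr => ts.
by apply: V_down Vs _ => i; rewrite !mxE lerD2l ltW.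
Qed.

Lemma sup_lipschitz_height : sup_lipschitz 1 height.
Proof.
move=> x y e e0 xye; rewrite mul1r leNgt; apply/negP.
(* The midpoint of [height y] and [height x - e] leaves room on both sides. *)
rewrite -ltrBrDr => lt_xy; have := height_gt (t := (height y + height x - e) / 2 + e).
have /[swap] /[apply] Vx : (height y + height x - e) / 2 + e < height x by lra.
have : V (y + const_mx ((height y + height x - e) / 2)).
  apply: V_down Vx _ => i; rewrite !mxE; have := xye i.
  by have := ler_norm (- (x i 0 - y i 0)); rewrite normrN; lra.
by move/height_ge; lra.
Qed.

Lemma height_shift u s : height (u + const_mx s) = height u - s.
Proof.
have E t : u + const_mx s + const_mx t = u + const_mx (s + t) :> 'cV[R]_n.
  by apply/matrixP => i l; rewrite !mxE addrA.
apply/eqP; rewrite eq_le; apply/andP; split; rewrite leNgt; apply/negP => lt_h.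
  have := height_gt (u := u + const_mx s)
    (t := (height (u + const_mx s) + (height u - s)) / 2).
  by rewrite E => /(_ _)/height_ge; lra.
have := height_gt (u := u) (t := (height (u + const_mx s) + (height u - s)) / 2 + s).
by rewrite addrC -E => /(_ _)/height_ge; lra.
Qed.

End Height.

Section CoreOfBalancedGame.
Variables (R : realType) (n : nat) (U : {set 'I_n.+1} -> set 'cV[R]_n.+1) (M : R).
Implicit Types (u : 'cV[R]_n.+1) (S : {set 'I_n.+1}) (s : 'I_n.+1 -> nat).
Hypothesis U_comprehensive : forall S u u',
  U S u -> (forall i, i \in S -> u' i 0 <= u i 0) -> U S u'.
Hypothesis U_bound : forall S u i, U S u -> i \in S -> u i 0 <= M.
Hypothesis U_singleton : forall i, U [set i]%SET 0.
Hypothesis U_nonempty : forall S, S != finset.set0 -> U S !=set0.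
Hypothesis U_closed : forall u,
  (forall e, 0 < e -> U [set: 'I_n.+1]%SET (u - const_mx e)) -> U [set: 'I_n.+1]%SET u.
Hypothesis U_balanced : balanced_game U.

Let W : set 'cV[R]_n.+1 := [set u | exists2 S, S != finset.set0 & U S u].

Let setI_neq0 i : [set i]%SET != finset.set0 :> {set 'I_n.+1}.
Proof. by apply/set0Pn; exists i; rewrite inE. Qed.

Let M_ge0 : 0 <= M.
Proof. by have := U_bound (U_singleton ord0) (set11 ord0); rewrite mxE. Qed.

Let U_down S u u' : U S u -> (forall i, u' i 0 <= u i 0) -> U S u'.
Proof. by move=> Su le; apply: U_comprehensive Su _. Qed.

Let U_bound1 S u : S != finset.set0 -> U S u -> exists i, u i 0 <= M.
Proof. by move=> /set0Pn[i iS] Su; exists i; apply: U_bound Su iS. Qed.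

Let W_down u u' : W u -> (forall i, u' i 0 <= u i 0) -> W u'.
Proof. by move=> [S S0 Su] le; exists S => //; apply: U_down Su le. Qed.

Let W_bound u : W u -> exists i, u i 0 <= M.
Proof. by move=> [S S0 Su]; apply: U_bound1 S0 Su. Qed.

Let W_nonempty : W !=set0.
Proof. by exists 0, [set ord0]%SET. Qed.

Let hW := height W.

Let height_geU S u t : S != finset.set0 -> U S (u + const_mx t) -> t <= height (U S) u.
Proof.
move=> S0; apply: (@height_ge R _ (U S) M); first exact: U_down.
  by move=> v; apply: U_bound1.
exact: U_nonempty.
Qed.

Let height_gtU S u t : S != finset.set0 -> t < height (U S) u -> U S (u + const_mx t).
Proof.
move=> S0; apply: (@height_gt R _ (U S) M); first exact: U_down.
  by move=> v; apply: U_bound1.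
exact: U_nonempty.
Qed.

Let height_geW u t : W (u + const_mx t) -> t <= hW u.
Proof. exact: (height_ge W_down W_bound W_nonempty). Qed.

Let height_gtW u t : t < hW u -> W (u + const_mx t).
Proof. exact: (height_gt W_down W_bound W_nonempty). Qed.

Let lipW : sup_lipschitz 1 hW.
Proof. exact: (sup_lipschitz_height W_down W_bound W_nonempty). Qed.

Let lipU S : S != finset.set0 -> sup_lipschitz 1 (height (U S)).
Proof.
move=> S0; apply: (@sup_lipschitz_height R _ (U S) M); first exact: U_down.
  by move=> v; apply: U_bound1.
exact: U_nonempty.
Qed.

(** Player [i] alone secures 0, so a negative coordinate could be raised within [U [set i]]. *)
Let unblocked_ge0 u i : hW u <= 0 -> 0 <= u i 0.
Proof.
move=> u0; rewrite leNgt; apply/negP => ui.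
have : W (u + const_mx (- u i 0)).
  exists [set i]%SET => //; apply: U_comprehensive (U_singleton i) _ => l.
  by rewrite inE => /eqP ->; rewrite !mxE subrr.
by move/height_geW => /le_trans/(_ u0); rewrite oppr_le0 leNgt ui.
Qed.


(** * Equalizing the slacks of nearly effective coalitions *)

Section Slack.
Variable e : R.
Hypotheses (e_gt0 : 0 < e) (e_lt1 : e < 1).

Let excess S u : R := Num.max 0 (height (U S) u + e).

Let G i u : R := \sum_(S : {set 'I_n.+1} | i \in S) excess S u.

(** Deviation of [G i u] from the mean, scaled to avoid division. The [H i u] sum to 0, so one of
    them is at most 0. *)
Let H i u : R := n.+1%:R * G i u - \sum_l G l u.

Let excess_ge0 S u : 0 <= excess S u.
Proof. by rewrite le_max lexx. Qed.

Let G_ge0 i u : 0 <= G i u.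
Proof. by apply: sumr_ge0. Qed.

Let H_sum u : \sum_i H i u = 0.
Proof.
by rewrite sumrB -mulr_sumr sumr_const card_ord mulr_natl subrr.
Qed.

Let lipH : exists2 L, 0 <= L & forall i, sup_lipschitz L (H i).
Proof.
pose k i : R := \sum_(S : {set 'I_n.+1} | i \in S) 1.
have k_ge0 i : 0 <= k i by apply: sumr_ge0.
have lipG i : sup_lipschitz (k i) (G i).
  apply: sup_lipschitz_sum => S iS; apply: sup_lipschitz_max0 => //.
  rewrite -[1]addr0; apply: sup_lipschitzD; last exact: sup_lipschitz_cst.
  by apply: lipU; apply/set0Pn; exists i.
exists (n.+1%:R * (\sum_i k i) + \sum_i k i) => [|i].
  by rewrite addr_ge0 ?mulr_ge0 ?sumr_ge0.
apply: sup_lipschitzD; last first.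
  by apply/sup_lipschitzN/sup_lipschitz_sum => l _; apply: lipG.
apply: sup_lipschitzMl => //; apply: sup_lipschitzW (lipG i).
by rewrite (bigD1 i) //= lerDl sumr_ge0.
Qed.

(* No coalition containing [i] is nearly effective here, which takes care of the
   points close to a face of the simplex, where color [i] may be missing. *)
Let H_face u i : M + 1 <= u i 0 -> H i u <= 0.
Proof.
move=> ui; rewrite /H; suff -> : G i u = 0.
  by rewrite mulr0 sub0r oppr_le0 sumr_ge0.
apply: big1 => S iS; apply/max_idPl.
have S0 : S != finset.set0 by apply/set0Pn; exists i.
rewrite -lerBrDr sub0r leNgt; apply/negP => /(height_gtU S0)/U_bound/(_ iS).
by rewrite !mxE => ui_le; have := e_lt1; lra.
Qed.

(** Size of the simplex, large enough for [frontier_point_face]. *)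
Let c : R := 2 * n.+1%:R * (M + 1).

Let c_ge0 : 0 <= c.
Proof. by rewrite !mulr_ge0 // addr_ge0. Qed.

(** The minus sign makes coordinate [i] large where [s i] is small, that is, near the face [i]. *)
Let frontier_point (m : nat) (s : 'I_n.+1 -> nat) : 'cV[R]_n.+1 :=
  let z : 'cV[R]_n.+1 := \col_i - (c * (s i)%:R / m%:R) in z + const_mx (hW z).

Let frontier_point_height m s : hW (frontier_point m s) = 0.
Proof.
by rewrite /frontier_point /hW (height_shift W_down W_bound W_nonempty) subrr.
Qed.

Let frontier_pointE m s i l : frontier_point m s i 0 =
  frontier_point m s l 0 + c * (s l)%:R / m%:R - c * (s i)%:R / m%:R.
Proof. by rewrite !mxE; ring. Qed.

(** The factor 2 adds the move of the grid point to that of its height, which is 1-Lipschitz. *)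
Let frontier_point_close m s s' d : (forall l, (s l <= s' l + d)%N /\ (s' l <= s l + d)%N) ->
  forall l, `|frontier_point m s l 0 - frontier_point m s' l 0| <= 2 * (c * d%:R / m%:R).
Proof.
move=> ss'.
pose z s : 'cV[R]_n.+1 := \col_i - (c * (s i : nat)%:R / m%:R).
have c1 s1 s2 l : (s1 l <= s2 l + d)%N ->
    c * (s1 l)%:R / m%:R <= c * (s2 l : nat)%:R / m%:R + c * d%:R / m%:R.
  move=> s12; rewrite -mulrDl -mulrDr ler_wpM2r ?invr_ge0 //.
  by rewrite ler_wpM2l // -natrD ler_nat.
have zz l : `|z s l 0 - z s' l 0| <= c * d%:R / m%:R.
  have [a b] := ss' l; rewrite !mxE ler_distl.
  by have := c1 _ _ _ a; have := c1 _ _ _ b; lra.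
have d0 : 0 <= c * d%:R / m%:R by rewrite divr_ge0 // mulr_ge0.
have h1 := lipW d0 zz.
have h2 : hW (z s') <= hW (z s) + 1 * (c * d%:R / m%:R).
  by apply: lipW => // l; rewrite distrC.
move=> l; have := zz l; rewrite /frontier_point -/(z s) -/(z s').
rewrite [(z s + _) _ _]mxE [(z s' + _) _ _]mxE ![const_mx _ _ _]mxE.
by rewrite !ler_distl; lra.
Qed.

(** Lowered by 1, the point lies in some U(S), so one coordinate is at most [M + 1]; any two
    coordinates differ by at most [c]. *)
Let frontier_point_bound m s : (0 < m)%N -> \sum_i s i = m -> forall l,
  0 <= frontier_point m s l 0 <= M + 1 + c.
Proof.
move=> m0 sm l; rewrite unblocked_ge0 ?frontier_point_height //=.
have [|S S0 /U_bound US] := @height_gtW (frontier_point m s) (- 1).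
  by rewrite frontier_point_height; lra.
have /set0Pn[i iS] := S0; have := US _ iS; rewrite !mxE => ui.
have := frontier_pointE m s l i; rewrite !mxE => ->.
have le1 k : c * (s k)%:R / m%:R <= c.
  rewrite -mulrA ler_piMr // ler_pdivrMr ?ltr0n // mul1r ler_nat.
  by rewrite -sm (bigD1 k) //= leq_addr.
have : 0 <= c * (s l)%:R / m%:R by rewrite divr_ge0 // mulr_ge0.
by have := le1 i; lra.
Qed.

(** Some [s l] is at least the average [m / n.+1], and coordinate [l] is nonnegative. Passing to
    coordinate [i] gains at least [2 * (M + 1)] and loses at most [M + 1]. *)
Let frontier_point_face m s i : (2 * n.+1 * n.+1 <= m)%N -> \sum_i s i = m ->
  (s i <= n.+1)%N -> M + 1 <= frontier_point m s i 0.
Proof.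
move=> mn sm si.
have m0 : (0 < m)%N by apply: leq_trans mn.
have [l sl] : exists l, (m <= s l * n.+1)%N.
  apply/existsP; apply: contraT => /existsPn lt_s.
  have : (\sum_l s l * n.+1 < \sum_(l < n.+1) m)%N.
    rewrite [ltnLHS](bigD1 ord0) //= [ltnRHS](bigD1 ord0) //= -addSn leq_add //.
      by rewrite ltnNge.
    by apply: leq_sum => k _; rewrite ltnW // ltnNge.
  by rewrite -big_distrl /= sm sum_nat_const card_ord mulnC ltnn.
have := unblocked_ge0 (u := frontier_point m s) l.
rewrite frontier_point_height => /(_ (lexx 0)).
rewrite (frontier_pointE m s i l); set ul := frontier_point m s l 0 => ul0.
have mR : 0 < m%:R :> R by rewrite ltr0n.
have slR : m%:R <= (s l)%:R * n.+1%:R :> R by rewrite -natrM ler_nat.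
have siR : (s i)%:R <= n.+1%:R :> R by rewrite ler_nat.
have mnR : 2 * n.+1%:R * n.+1%:R <= m%:R :> R by rewrite -!natrM ler_nat.
have : 2 * (M + 1) <= c * (s l)%:R / m%:R.
  rewrite ler_pdivlMr // /c -!mulrA ler_wpM2l // [n.+1%:R * _]mulrCA.
  by rewrite ler_wpM2l ?addr_ge0 // mulrC.
have : c * (s i)%:R / m%:R <= M + 1.
  rewrite ler_pdivrMr // /c mulrAC [leRHS]mulrC ler_wpM2r ?addr_ge0 //.
  by apply: le_trans mnR; rewrite ler_wpM2l // mulr_ge0.
lra.
Qed.

Let near_balanced k : 0 < k -> exists2 u : 'cV[R]_n.+1,
  (forall l, 0 <= u l 0 <= M + 1 + c) & hW u = 0 /\ forall i, H i u <= k.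
Proof.
move=> k0; have [L L0 lipL] := lipH.
pose d := L * (2 * (c * n.+1%:R)) / k.
have d0 : 0 <= d by rewrite divr_ge0 ?(ltW k0) // !mulr_ge0 // addr_ge0.
(* The first summand serves the points near a face; the second keeps the Lipschitz error at most
   [k]. *)
pose m := (2 * n.+1 * n.+1 + Num.bound d)%N.
have m0 : (0 < m)%N by [].
pose label s := odflt ord0 [pick i | H i (frontier_point m s) <= 0].
have labelP s : H (label s) (frontier_point m s) <= 0.
  rewrite /label; case: pickP => //= none.
  have := H_sum (frontier_point m s); have : 0 < \sum_i H i (frontier_point m s).
    rewrite (bigD1 ord0) //= ltr_pwDl //; first by rewrite ltNge none.
    by apply: sumr_ge0 => i _; rewrite ltW // ltNge none.
  by move=> + eq0; rewrite eq0 ltxx.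
have [s sm sP] := grid_coloring m label.
exists (frontier_point m s); first exact: frontier_point_bound.
split=> [|i]; first exact: frontier_point_height.
case: (sP i) => [[s' [sm' <- ss']]|si]; last first.
  by apply: le_trans (ltW k0); apply/H_face/frontier_point_face; rewrite ?leq_addr.
have b0 : 0 <= 2 * (c * n.+1%:R / m%:R) by rewrite mulr_ge0 // divr_ge0 // mulr_ge0.
apply: le_trans (lipL _ _ _ _ b0 (frontier_point_close m ss')) _.
rewrite -[leRHS]add0r lerD ?labelP //.
have -> : L * (2 * (c * n.+1%:R / m%:R)) = d * k / m%:R.
  by rewrite /d divfK ?gt_eqF // !mulrA.
rewrite ler_pdivrMr ?ltr0n // mulrC ler_wpM2l 1?ltW //.
by apply: lt_le_trans (archi_boundP d0) _; rewrite ler_nat leq_addl.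
Qed.

Lemma approximate_core : exists2 u : 'cV[R]_n.+1,
  (forall l, 0 <= u l 0 <= M + 1 + c) & hW u = 0 /\ U [set: 'I_n.+1]%SET (u - const_mx e).
Proof.
have [L _ lipL] := lipH.
pose f (i : 'I_n.+1 + bool) u := match i with
  | inl i => H i u | inr true => hW u | inr false => - hW u end.
pose K (i : 'I_n.+1 + bool) : R := if i is inl _ then L else 1.
have lipf i : sup_lipschitz (K i) (f i).
  by case: i => [i|[]]; [exact: lipL|exact: lipW|exact: sup_lipschitzN].
have [|u u_box uP] := box_limit (M := M + 1 + c) lipf.
  move=> k k0; have [u ub [u0 uH]] := near_balanced k0.
  by exists u => // -[i|[]] /=; rewrite ?u0 ?oppr0 // ltW.
have u0 : hW u = 0.
  by have := uP (inr true); have := uP (inr false); rewrite /=; lra.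
have H0 i : H i u = 0.
  apply/eqP; rewrite eq_le (uP (inl i)) /= leNgt; apply/negP => lt0.
  suff : \sum_l H l u < 0 by rewrite H_sum ltxx.
  rewrite (bigD1 i) //= ltr_nwDl // sumr_le0 // => l _; exact: (uP (inl l)).
pose g := \sum_l G l u.
have Gg i : n.+1%:R * G i u = g by apply/eqP; rewrite -subr_eq0 -[X in X == _]/(H i u) H0.
have activeU S i : i \in S -> 0 < excess S u -> U S (u - const_mx e).
  move=> iS; rewrite lt_max ltxx /= -ltrBlDr sub0r.
  rewrite -[u - _]/(u + (- const_mx e)).
  have -> : - const_mx e = const_mx (- e) :> 'cV[R]_n.+1 by apply/matrixP => ? ?; rewrite !mxE.
  by apply: height_gtU; apply/set0Pn; exists i.
(* Since [hW u = 0], some coalition contains [u] lowered by [e / 2]; its excess is at least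
   [e / 2]. *)
have g_gt0 : 0 < g.
  have [|S S0 US] := @height_gtW u (- (e / 2)).
    by rewrite u0 oppr_lt0 divr_gt0.
  have /set0Pn[i iS] := S0; rewrite -(Gg i) mulr_gt0 ?ltr0n //.
  rewrite /G (bigD1 S) //= ltr_pwDl ?sumr_ge0 // lt_max; apply/orP; right.
  by have := height_geU S0 US; have := e_gt0; lra.
exists u => //; split=> //.
apply: (U_balanced (C := [set S | (S != finset.set0) && (0 < excess S u)]%SET)).
  split; first by rewrite inE eqxx.
  (* The weights of the coalitions containing [i] add up to [n.+1%:R * G i u / g], which is 1
     because all [G i u] agree. *)
  exists (fun S => n.+1%:R * excess S u / g); split=> [S _|i].
    by rewrite divr_ge0 ?mulr_ge0 // ltW.
  rewrite -mulr_suml -mulr_sumr; apply/eqP.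
  rewrite -(inj_eq (mulIf (lt0r_neq0 g_gt0))) mul1r divfK ?lt0r_neq0 // -(Gg i).
  apply/eqP; congr (_ * _); rewrite /G [RHS](bigID (fun S => 0 < excess S u)) /=.
  rewrite [X in _ = _ + X]big1 ?addr0; last first.
    by move=> S /andP[_]; rewrite -leNgt => S0; apply/eqP; rewrite eq_le S0 /=.
  apply: eq_bigl => S; rewrite inE.
  have [iS|] := boolP (i \in S); last by rewrite andbF.
  by rewrite andbT; have -> : S != finset.set0 by apply/set0Pn; exists i.
by move=> S /=; rewrite inE => /andP[/set0Pn[i iS]]; exact: activeU iS.
Qed.

End Slack.

(** As [e] tends to 0, [box_limit] yields a point with [hW u <= 0], hence unblocked, and of
    nonnegative height in U(N), hence in U(N) by [U_closed]. *)
Theorem balanced_core_nonempty : core U !=set0.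
Proof.
have T0 : [set: 'I_n.+1]%SET != finset.set0 by apply/set0Pn; exists ord0; rewrite inE.
pose f (b : bool) u := if b then hW u else - height (U [set: 'I_n.+1]%SET) u.
have lipf b : sup_lipschitz 1 (f b).
  by case: b; [exact: lipW|exact/sup_lipschitzN/lipU].
have constN e : const_mx (- e) = - const_mx e :> 'cV[R]_n.+1.
  by apply/matrixP => ? ?; rewrite !mxE.
have [|u _ uP] := box_limit (M := M + 1 + 2 * n.+1%:R * (M + 1)) lipf.
  (* The cap meets the requirement of [approximate_core] that the slack be below 1. *)
  move=> e e0; pose e' := Num.min e (1 / 2).
  have e'0 : 0 < e' by rewrite lt_min e0 divr_gt0.
  have [|u ub [u0 uU]] := approximate_core e'0.
    by rewrite gt_min; apply/orP; right; lra.
  exists u => // -[]; rewrite /f; first by rewrite u0 ltW.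
  rewrite lerNl.
  have : - e' <= height (U [set: 'I_n.+1]%SET) u.
    by apply: height_geU => //; rewrite constN.
  by apply: le_trans; rewrite lerN2 ge_min lexx.
have u0 : hW u <= 0 by exact: (uP true).
have uT : 0 <= height (U [set: 'I_n.+1]%SET) u by rewrite -oppr_le0; exact: (uP false).
exists u; split.
  apply: U_closed => e e0; rewrite -constN; apply: height_gtU => //.
  by apply: lt_le_trans uT; rewrite oppr_lt0.
move=> [S /= S0 uS].
(* An interior point can be raised along the diagonal, which would make [hW u] positive. *)
have [t t0 tS] : exists2 t, 0 < t & U S (u + const_mx t).
  have /nbhs_ballP[d /= d0 dS] : nbhs u (U S) by exact: uS.
  exists (d / 2); first by rewrite divr_gt0.
  apply/dS; split=> // i l; rewrite /ball /= !mxE opprD addNKr normrN.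
  by rewrite gtr0_norm ?divr_gt0 // ltr_pdivrMr // ltr_pMr // ltr1n.
have : t <= hW u by apply: height_geW; exists S.
by move/le_trans/(_ u0); rewrite leNgt t0.
Qed.

End CoreOfBalancedGame.

(** * Linear production games *)

Lemma sup_lipschitz_mulmx (R : realType) (p q : nat) (B : 'M[R]_(p, q)) r :
  sup_lipschitz (\sum_l `|B r l|) (fun x => (B *m x) r 0).
Proof.
move=> x y e e0 xye; rewrite !mxE mulr_suml -big_split /=; apply: ler_sum => l _.
rewrite -lerBlDl -mulrBr (le_trans (ler_norm _)) // normrM ler_wpM2l //.
Qed.

Section LinearProductionGame.
Variables (R : realType) (n k j : nat).
Variables (A : 'M[rat]_(k, j)) (b : 'I_n -> 'cV[rat]_k) (v : 'I_n -> 'cV[rat]_j).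

Let X := feasible R A b.
Let val i (x : 'cV[R]_j) : R := ((valuation R v i)^T *m x) 0 0.

Lemma ntulpP S (u : 'cV[R]_n) :
  ntulp R A b v S u <-> exists2 x, X S x & forall i, i \in S -> u i 0 <= val i x.
Proof.
split=> [[[x u'] /= [xS ux] <-]|[x xS ux]]; first by exists x.
by exists (x, u).
Qed.

Lemma ratr_endowment S r :
  ratr (endowment b S r 0) = \sum_(i in S) ratr (b i r 0) :> R.
Proof. by rewrite /endowment summxE raddf_sum. Qed.

(** Exchanging the sums, the weighted endowments add up to exactly b(T), so endowments of any sign
    are allowed. *)
Lemma feasible_combination (C : {set {set 'I_n}}) (w : {set 'I_n} -> R)
    (x : {set 'I_n} -> 'cV[R]_j) (T : {set 'I_n}) :
  (forall S, S \in C -> 0 <= w S /\ X S (x S)) ->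
  (forall i, \sum_(S in C | i \in S) w S = (i \in T)%:R) ->
  X T (\sum_(S in C) w S *: x S).
Proof.
move=> Cx wT; split=> [l|r].
  rewrite summxE sumr_ge0 // => S /Cx[w0 [xS _]].
  by rewrite mxE mulr_ge0.
rewrite mulmx_sumr summxE ratr_endowment.
apply: (@le_trans _ _ (\sum_(S in C) \sum_(i in S) w S * ratr (b i r 0))).
  apply: ler_sum => S /Cx[w0 [_ xS]].
  by rewrite -scalemxAr mxE -mulr_sumr ler_wpM2l // -ratr_endowment.
rewrite (exchange_big_dep predT) //= [leRHS]big_mkcond /= le_eqVlt; apply/orP; left.
apply/eqP/eq_bigr => i _; rewrite -mulr_suml wT.
by case: (i \in T); rewrite ?mul1r ?mul0r.
Qed.

Lemma valuation_combination (I : finType) (P : pred I) (w : I -> R)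
    (x : I -> 'cV[R]_j) i :
  val i (\sum_(l | P l) w l *: x l) = \sum_(l | P l) w l * val i (x l).
Proof.
rewrite /val mulmx_sumr summxE; apply: eq_bigr => l _.
by rewrite -scalemxAr mxE.
Qed.

Hypothesis v_dual : forall i S x, S != finset.set0 -> X S x -> 0 <= val i x.

Lemma ntulp_balanced : balanced_game (ntulp R A b v).
Proof.
move=> C [C0 [w [w0 w1]]] u uC.
have /choice[x xP] S : exists x, S \in C -> X S x /\ forall i, i \in S -> u i 0 <= val i x.
  have [SC|_] := boolP (S \in C); last by exists 0.
  by have /ntulpP[x xS ux] := uC S SC; exists x.
apply/ntulpP; exists (\sum_(S in C) w S *: x S).
  apply: feasible_combination => [S SC|i]; last by rewrite w1 inE.
  by have [xS _] := xP S SC; split=> //; apply: w0.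
move=> i _; rewrite valuation_combination (bigID (fun S : {set 'I_n} => i \in S)) /=.
rewrite -[leLHS]addr0 lerD //.
  rewrite -[leLHS]mul1r -(w1 i) mulr_suml; apply: ler_sum => S /andP[SC iS].
  by rewrite ler_wpM2l ?w0 //; have [_] := xP S SC; apply.
apply: sumr_ge0 => S /andP[SC _]; rewrite mulr_ge0 ?w0 //.
by have [xS _] := xP S SC; apply: v_dual xS; apply: contraTneq SC => ->.
Qed.

Hypothesis X_nonempty : forall i, X [set i]%SET !=set0.

Lemma feasible_nonempty S : X S !=set0.
Proof.
have /choice[x xX] := X_nonempty.
exists (\sum_(i in S) 1 *: x i); split=> [l|r].
  rewrite summxE sumr_ge0 // => i _; rewrite scale1r; exact: (xX i).1.
rewrite mulmx_sumr summxE ratr_endowment; apply: ler_sum => i _.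
by rewrite scale1r; have := (xX i).2 r; rewrite ratr_endowment big_set1.
Qed.

Hypothesis X_bounded : forall i, bounded_set (X [set i]%SET).

Lemma no_recession (i : 'I_n) (d : 'cV[R]_j) : (forall l, 0 <= d l 0) ->
  (forall r, (map_mx ratr A *m d) r 0 <= 0) -> forall l, d l 0 = 0.
Proof.
move=> d0 Ad l; apply/eqP; rewrite eq_le d0 andbT leNgt; apply/negP => dl.
have [x [x0 Ax]] := X_nonempty i.
have [M [_ /(_ (`|M| + 1))]] := X_bounded i.
rewrite (le_lt_trans (ler_norm _)) ?ltrDl // => /(_ isT) XM.
(* Along the ray from [x], coordinate [l] then exceeds the norm bound [|M| + 1]. *)
pose t := (`|M| + 2) / d l 0.
have t0 : 0 <= t by rewrite divr_ge0 // addr_ge0.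
have /XM : X [set i]%SET (x + t *: d).
  split=> [m|r]; first by rewrite !mxE addr_ge0 // mulr_ge0.
  rewrite mulmxDr -scalemxAr [leLHS]mxE -[leRHS]addr0 lerD // mxE.
  by rewrite mulr_ge0_le0.
apply/negP; rewrite -ltNge; apply: lt_le_trans (_ : `|(x + t *: d) l 0| <= _).
  rewrite !mxE divfK ?gt_eqF // (@ger0_norm _ (_ + _)) ?addr_ge0 //.
  by have := x0 l; lra.
rewrite [leRHS](mx_normrE (x + t *: d)).
apply/bigmax_geP; right; by exists (l, 0).
Qed.

(** All X(S) share the recession cone, which is trivial. By compactness, a nonnegative vector of
    coordinate sum 1 violates some row of [A x <= 0] by more than a uniform [e]; scaling bounds the
    sum of any feasible [x]. *)
Lemma feasible_bounded (i0 : 'I_n) : exists M, forall S x, X S x -> forall l, 0 <= x l 0 <= M.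
Proof.
pose f (i : 'I_k + unit) (x : 'cV[R]_j) := match i with
  | inl r => (map_mx ratr A *m x) r 0 | inr _ => 1 - \sum_l x l 0 end.
pose K (i : 'I_k + unit) : R := match i with
  | inl r => \sum_l `|(map_mx ratr A : 'M[R]_(k, j)) r l| | inr _ => 0 + \sum_(l < j) 1 end.
have lipf i : sup_lipschitz (K i) (f i).
  case: i => [r|[]]; first exact: sup_lipschitz_mulmx.
  apply: sup_lipschitzD; first exact: sup_lipschitz_cst.
  apply/sup_lipschitzN/sup_lipschitz_sum => l _ x y e _ /(_ l).
  rewrite ler_distl; lra.
have [e e0 eP] : exists2 e, 0 < e & forall x : 'cV[R]_j, (forall l, 0 <= x l 0 <= 1) ->
    exists i, e < f i x.
  apply: contrapT => none; have [|x xb xf] := box_limit (M := 1) lipf.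
    move=> e e0; apply: contrapT => none_e; apply: none; exists e => // x xb.
    apply: contrapT => lt_f; apply: none_e; exists x => // i.
    by rewrite leNgt; apply/negP => efi; apply: lt_f; exists i.
  have x0 l : 0 <= x l 0 by have /andP[] := xb l.
  have := xf (inr tt); rewrite /f big1 ?subr0 ?ler10 // => l _.
  apply: (no_recession i0) => // r; exact: (xf (inl r)).
pose B : R := \sum_S \sum_r `|ratr (endowment b S r 0)|.
exists (B / e) => S x [x0 Ax] l; rewrite x0 /=.
pose s := \sum_l x l 0.
have s0 : 0 <= s by apply: sumr_ge0.
have le_s m : x m 0 <= s by rewrite /s (bigD1 m) //= lerDl sumr_ge0.
apply: le_trans (le_s l) _; rewrite ler_pdivlMr //.
have B0 : 0 <= B by apply: sumr_ge0 => *; apply: sumr_ge0.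
have [->|s_neq0] := eqVneq s 0; first by rewrite mul0r.
have s_gt0 : 0 < s by rewrite lt_neqAle eq_sym s_neq0.
have [m|[r|[]]] := eP (s^-1 *: x).
- by rewrite mxE mulrC divr_ge0 ?ler_pdivrMr //= mul1r le_s.
- rewrite /f -scalemxAr mxE mulrC ltr_pdivlMr // mulrC => /ltW/le_trans -> //.
  apply: le_trans (Ax r) _; apply: le_trans (ler_norm _) _.
  rewrite /B (bigD1 S) //= (bigD1 r) //= -addrA lerDl addr_ge0 ?sumr_ge0 //.
  by move=> *; rewrite sumr_ge0.
rewrite /f (eq_bigr (fun m => s^-1 * x m 0)) => [|m _]; last by rewrite mxE.
by rewrite -mulr_sumr mulVf // subrr ltNge ltW.
Qed.

End LinearProductionGame.

Theorem theorem3p3 (R : realType) (n k j : nat)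
  (A : 'M[rat]_(k.+1, j.+1)) (b : 'I_n.+1 -> 'cV[rat]_k.+1)
  (v : 'I_n.+1 -> 'cV[rat]_j.+1)
  (X_nonempty : forall i : 'I_n.+1, feasible R A b [set i]%SET !=set0)
  (X_bounded : forall i : 'I_n.+1, bounded_set (feasible R A b [set i]%SET))
  (v_dual : forall i : 'I_n.+1,
     (\bigcap_(S in [set S : {set 'I_n.+1} | S != finset.set0])
        dual_cone (feasible R A b S)) (valuation R v i)) :
  balanced_game (ntulp R A b v) /\ core (ntulp R A b v) !=set0.
Proof.
pose val i (x : 'cV[R]_j.+1) : R := ((valuation R v i)^T *m x) 0 0.
have dual i S x : S != finset.set0 -> feasible R A b S x -> 0 <= val i x.
  by move=> S0 xS; apply: (v_dual i S S0).
have bal := ntulp_balanced dual; split=> //.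
have [M XM] := feasible_bounded X_nonempty X_bounded ord0.
have lip_val i : sup_lipschitz (\sum_l `|(valuation R v i)^T 0 l|) (val i).
  exact: sup_lipschitz_mulmx.
apply: (@balanced_core_nonempty R n _ (\sum_i \sum_l `|(valuation R v i)^T 0 l| * M)) => //.
- move=> S u u' /ntulpP[x xS ux] u'u; apply/ntulpP; exists x => // i iS.
  exact: le_trans (u'u i iS) (ux i iS).
- move=> S u i /ntulpP[x xS /(_ i)] /[apply] /le_trans; apply.
  rewrite (bigD1 i) //= -[leLHS]addr0 lerD //; last first.
    apply: sumr_ge0 => l _; apply: sumr_ge0 => m _; rewrite mulr_ge0 //.
    (* [M] is nonnegative because it bounds the coordinate [ord0] of a feasible point. *)
    by have /andP[] := XM _ _ xS ord0; exact: le_trans.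
  rewrite mxE; apply: ler_sum => l _; have /andP[x0 xM] := XM _ _ xS l.
  apply: le_trans (ler_norm _) _; rewrite normrM ler_wpM2l //.
  by rewrite ger0_norm.
(* The dual cone condition makes every feasible value nonnegative, so 0 is attainable by [i]
   alone. *)
- move=> i; have [x xi] := X_nonempty i; apply/ntulpP; exists x => // l _.
  by rewrite mxE; apply: dual xi; apply/set0Pn; exists i; rewrite inE.
- move=> S _; have [x xS] := feasible_nonempty X_nonempty S.
  by exists (\col_i val i x); apply/ntulpP; exists x => // i _; rewrite mxE.
(* U(N) is closed along the diagonal: production plans for [u] lowered by [e] stay in one box, and
   [box_limit] turns them into a plan for [u]. *)
- move=> u uT.
  pose f (i : 'I_k.+1 + 'I_n.+1) (x : 'cV[R]_j.+1) := match i with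
    | inl r => (map_mx ratr A *m x) r 0 - ratr (endowment b [set: 'I_n.+1]%SET r 0)
    | inr i => u i 0 - val i x end.
  pose K (i : 'I_k.+1 + 'I_n.+1) : R := match i with
    | inl r => \sum_l `|(map_mx ratr A : 'M[R]_(k.+1, j.+1)) r l| + 0
    | inr i => 0 + \sum_l `|(valuation R v i)^T 0 l| end.
  have lipf i : sup_lipschitz (K i) (f i).
    case: i => i; apply: sup_lipschitzD; try exact: sup_lipschitz_cst.
      exact: sup_lipschitz_mulmx.
    exact: sup_lipschitzN.
  have [|x xb xf] := box_limit (M := M) lipf.
    move=> e /[dup] e0 /uT/ntulpP[x xT ux]; exists x; first exact: XM xT.
    case=> i; rewrite /f.
      by rewrite (le_trans _ (ltW e0)) // subr_le0; apply: xT.2.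
    have := ux i (finset.in_setT i); rewrite [leLHS]mxE [X in _ + X]mxE [const_mx _ _ _]mxE.
    by rewrite lerBlDr lerBlDl addrC.
  apply/ntulpP; exists x => [|i _]; last by have := xf (inr i); rewrite /f subr_le0.
  split=> [l|r]; first by have /andP[] := xb l.
  by have := xf (inl r); rewrite /f subr_le0.
Qed.
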